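(* Let $p\colon\mathcal{M}\to\Delta^1$ be an adjunction associated to functors $f\colon\mathcal{C}\to\mathcal{D}$ and $g\colon\mathcal{D}\to\mathcal{C}$ via data $u\colon\mathcal{C}\times\Delta^1\to\mathcal{M}$ and $v\colon\mathcal{D}\times\Delta^1\to\mathcal{M}$. Let $s\colon K\to\Delta^1$ be a map of simplicial sets and $i\colon K'\hookrightarrow K$ a monomorphism such that the map induced by $i$ on fibers over $\{1\}$ (of $s\circ i$ and $s$) is an isomorphism. Let $\tilde\alpha'\colon K'\to\mathcal{D}$ and $\alpha\colon K\to\mathcal{C}$ be maps, and put $\alpha'=\alpha\circ i$. Suppose that $\tilde\alpha'$ is adjunct to $\alpha'$ relative to $s\circ i$. Then there exists $\tilde\alpha\colon K\to\mathcal{D}$ with $\tilde\alpha\circ i=\tilde\alpha'$ such that $\tilde\alpha$ is adjunct to $\alpha$ relative to $s$. Furthermore, any two such lifts $\tilde\alpha$ are equivalent as functors $K\to\mathcal{D}$.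
   Context: An adjunction is a bicartesian (cartesian and cocartesian) fibration $p\colon\mathcal{M}\to\Delta^1$ of quasicategories. It is associated to functors $f\colon\mathcal{C}\to\mathcal{D}$, $g\colon\mathcal{D}\to\mathcal{C}$ via $(u,v)$ if (identifying $\mathcal{M}_0=\mathcal{C}$ and $\mathcal{M}_1=\mathcal{D}$ by chosen isomorphisms, which is the standing convention) $u\colon\mathcal{C}\times\Delta^1\to\mathcal{M}$ and $v\colon\mathcal{D}\times\Delta^1\to\mathcal{M}$ are maps over $\Delta^1$ such that $u|\mathcal{C}\times\{0\}=\mathrm{id}_{\mathcal{C}}$, $u|\mathcal{C}\times\{1\}=f$, each $u|\{c\}\times\Delta^1$ is $p$-cocartesian; and $v|\mathcal{D}\times\{1\}=\mathrm{id}_{\mathcal{D}}$, $v|\mathcal{D}\times\{0\}=g$, each $v|\{d\}\times\Delta^1$ is $p$-cartesian. For $s\colon K\to\Delta^1$ with fibers $K_0,K_1$, maps $\alpha\colon K\to\mathcal{C}$ and $\tilde\alpha\colon K\to\mathcal{D}$ are adjunct relative to $s$ if there is a map $A\colon K\times\Delta^1\to\mathcal{M}$ with $p\circ A=\mathrm{pr}_{\Delta^1}$ such that: (1) $A|K\times\{0\}=\alpha$; (2) $A|K\times\{1\}=\tilde\alpha$; (3) $A|K_0\times\Delta^1$ equals $K_0\times\Delta^1\hookrightarrow K\times\Delta^1\xrightarrow{\alpha\times\mathrm{id}}\mathcal{C}\times\Delta^1\xrightarrow{u}\mathcal{M}$; (4) $A|K_1\times\Delta^1$ equals $K_1\times\Delta^1\hookrightarrow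 K\times\Delta^1\xrightarrow{\tilde\alpha\times\mathrm{id}}\mathcal{D}\times\Delta^1\xrightarrow{v}\mathcal{M}$. *)

(* Defs.v *)
From HB Require Import structures.
From mathcomp Require Import all_boot.
From mathcomp Require Import boolp.

Set Implicit Arguments.
Unset Strict Implicit.
Unset Printing Implicit Defensive.

(* The object [n] = {0 < ... < n} is 'I_n.+1. *)
Definition monotone m n (f : {ffun 'I_m.+1 -> 'I_n.+1}) : bool :=
  [forall i : 'I_m.+1, forall j : 'I_m.+1, (i <= j) ==> (f i <= f j)].

Record Dhom (m n : nat) := DHom {
  dfun :> {ffun 'I_m.+1 -> 'I_n.+1};
  dfun_monotone : monotone dfun }.

HB.instance Definition _ m n := [isSub for @dfun m n].
HB.instance Definition _ m n := [Equality of Dhom m n by <:].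

Lemma monotoneP m n (f : {ffun 'I_m.+1 -> 'I_n.+1}) :
  reflect (forall i j : 'I_m.+1, i <= j -> f i <= f j) (monotone f).
Proof.
apply: (iffP forallP) => [mf i j | mf i].
  by move/(_ i)/forallP/(_ j)/implyP: mf; apply.
by apply/forallP => j; apply/implyP; apply: mf.
Qed.

Lemma Dhom_ext m n (f g : Dhom m n) : f =1 g -> f = g.
Proof. by move=> fg; apply/val_inj/ffunP. Qed.

Fact did_subproof n : monotone [ffun i : 'I_n.+1 => i].
Proof. by apply/monotoneP => i j; rewrite !ffunE. Qed.
Definition did n : Dhom n n := DHom (did_subproof n).

Fact dcomp_subproof k m n (g : Dhom m n) (f : Dhom k m) :
  monotone [ffun i => g (f i)].
Proof.
apply/monotoneP => i j ij; rewrite !ffunE.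
by apply: (monotoneP _ (dfun_monotone g)); apply: (monotoneP _ (dfun_monotone f)).
Qed.
Definition dcomp k m n (g : Dhom m n) (f : Dhom k m) : Dhom k n :=
  DHom (dcomp_subproof g f).

Fact dconst_subproof m n (b : 'I_n.+1) : monotone [ffun _ : 'I_m.+1 => b].
Proof. by apply/monotoneP => i j _; rewrite !ffunE. Qed.
Definition dconst m n (b : 'I_n.+1) : Dhom m n := DHom (dconst_subproof m b).

Fact dface_subproof n (j : 'I_n.+2) : monotone [ffun i : 'I_n.+1 => lift j i].
Proof. by apply/monotoneP => i k ik; rewrite !ffunE /= leq_bump2. Qed.
Definition dface n (j : 'I_n.+2) : Dhom n n.+1 := DHom (dface_subproof j).

(* The map [1] -> [n] with values i, i+1. *)
Fact dspine_subproof n (i : 'I_n) :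
  monotone [ffun b : 'I_2 =>
    if b == ord0 then widen_ord (leqnSn n) i else lift ord0 i].
Proof.
apply/monotoneP => -[[|[|//]] p] [[|[|//]] q] pq; rewrite !ffunE //=.
Qed.
Definition dspine n (i : 'I_n) : Dhom 1 n := DHom (dspine_subproof i).

Record sset := SSet {
  simp :> nat -> Type;
  sact : forall m n, Dhom m n -> simp n -> simp m;
  sact_id : forall n (x : simp n), sact (did n) x = x;
  sact_comp : forall k m n (g : Dhom m n) (f : Dhom k m) (x : simp n),
    sact (dcomp g f) x = sact f (sact g x) }.

Record smap (X Y : sset) := SMap {
  sapp :> forall n, X n -> Y n;
  sapp_nat : forall m n (phi : Dhom m n) (x : X n),
    sapp (sact phi x) = sact phi (sapp x) }.
Arguments sapp {X Y} _ {n} _.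

Lemma smap_ext (X Y : sset) (a b : smap X Y) :
  (forall n (x : X n), a n x = b n x) -> a = b.
Proof.
case: a b => a na [b nb] /= ab.
have E : a = b by do 2 (apply: functional_extensionality_dep => ?).
by subst b; congr SMap; apply: Prop_irrelevance.
Qed.

Definition smap_id (X : sset) : smap X X :=
  @SMap X X (fun _ x => x) (fun _ _ _ _ => erefl).

Fact smap_comp_subproof (X Y Z : sset) (b : smap Y Z) (a : smap X Y)
    m n (phi : Dhom m n) (x : X n) :
  b m (a m (sact phi x)) = sact phi (b n (a n x)).
Proof. by rewrite !sapp_nat. Qed.
Definition smap_comp (X Y Z : sset) (b : smap Y Z) (a : smap X Y) : smap X Z :=
  @SMap X Z (fun n x => b n (a n x)) (smap_comp_subproof b a).

Declare Scope sset_scope.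
Delimit Scope sset_scope with sset.
Local Open Scope sset_scope.
Notation "b \os a" := (smap_comp b a) (at level 50, left associativity) :
  sset_scope.

Definition is_iso (X Y : sset) (a : smap X Y) : Prop :=
  exists b : smap Y X, b \os a = smap_id X /\ a \os b = smap_id Y.

Definition is_mono (X Y : sset) (a : smap X Y) : Prop :=
  forall n, injective (a n).

Fact sprod_id_subproof (X Y : sset) n (z : X n * Y n) :
  (sact (did n) z.1, sact (did n) z.2) = z.
Proof. by case: z => x y; rewrite !sact_id. Qed.
Fact sprod_comp_subproof (X Y : sset) k m n (g : Dhom m n) (f : Dhom k m)
    (z : X n * Y n) :
  (sact (dcomp g f) z.1, sact (dcomp g f) z.2) =
  (sact f (sact g z.1), sact f (sact g z.2)).
Proof. by rewrite !sact_comp. Qed.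
Definition sprod (X Y : sset) : sset :=
  @SSet (fun n => (X n * Y n)%type)
    (fun m n phi z => (sact phi z.1, sact phi z.2))
    (@sprod_id_subproof X Y) (@sprod_comp_subproof X Y).
Notation "X \xs Y" := (sprod X Y) (at level 40, left associativity) :
  sset_scope.

Definition sfst (X Y : sset) : smap (X \xs Y) X :=
  @SMap (X \xs Y) X (fun _ z => z.1) (fun _ _ _ _ => erefl).
Definition ssnd (X Y : sset) : smap (X \xs Y) Y :=
  @SMap (X \xs Y) Y (fun _ z => z.2) (fun _ _ _ _ => erefl).

Fact sprod_map_subproof (X Y X' Y' : sset) (a : smap X X') (b : smap Y Y')
    m n (phi : Dhom m n) (z : (X \xs Y) n) :
  (a m (sact phi z).1, b m (sact phi z).2) =
  sact phi ((a n z.1, b n z.2) : (X' \xs Y') n).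
Proof. by rewrite /= !sapp_nat. Qed.
Definition sprod_map (X Y X' Y' : sset) (a : smap X X') (b : smap Y Y') :
    smap (X \xs Y) (X' \xs Y') :=
  @SMap (X \xs Y) (X' \xs Y') (fun n z => (a n z.1, b n z.2))
    (sprod_map_subproof a b).

Fact sdelta_id_subproof d n (x : Dhom n d) : dcomp x (did n) = x.
Proof. by apply: Dhom_ext => i; rewrite !ffunE. Qed.
Fact sdelta_comp_subproof d k m n (g : Dhom m n) (f : Dhom k m) (x : Dhom n d) :
  dcomp x (dcomp g f) = dcomp (dcomp x g) f.
Proof. by apply: Dhom_ext => i; rewrite !ffunE. Qed.
Definition sdelta (d : nat) : sset :=
  @SSet (fun n => Dhom n d) (fun m n phi x => dcomp x phi)
    (@sdelta_id_subproof d) (@sdelta_comp_subproof d).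

Fact sdelta_map_subproof d e (f : Dhom d e) m n (phi : Dhom m n)
    (x : sdelta d n) :
  dcomp f (sact phi x) = sact phi (dcomp f x : sdelta e n).
Proof. by apply: Dhom_ext => i; rewrite !ffunE. Qed.
Definition sdelta_map d e (f : Dhom d e) : smap (sdelta d) (sdelta e) :=
  @SMap (sdelta d) (sdelta e) (fun _ x => dcomp f x) (sdelta_map_subproof f).

Definition vertex (X : sset) n (x : X n) (i : 'I_n.+1) : X 0 :=
  sact (dconst 0 i) x.
Definition source (X : sset) (e : X 1) : X 0 := vertex e ord0.
Definition target (X : sset) (e : X 1) : X 0 := vertex e ord_max.
Definition id_edge (X : sset) (x : X 0) : X 1 := sact (dconst 1 ord0) x.

(* The simplices of the k-th horn are those lying in some face opposite to a
   vertex j != k. *)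
Definition in_horn d (k : 'I_d.+1) n (x : Dhom n d) : bool :=
  [exists j : 'I_d.+1, (j != k) && [forall i, x i != j]].

Fact in_horn_act d (k : 'I_d.+1) m n (phi : Dhom m n) (x : Dhom n d) :
  in_horn k x -> in_horn k (dcomp x phi).
Proof.
case/existsP => j /andP [jk /forallP xj]; apply/existsP; exists j.
by rewrite jk; apply/forallP => i; rewrite ffunE.
Qed.

Definition horn_act d (k : 'I_d.+1) m n (phi : Dhom m n)
    (x : {x : Dhom n d | in_horn k x}) : {x : Dhom m d | in_horn k x} :=
  exist _ (dcomp (val x) phi) (in_horn_act phi (valP x)).
Fact horn_id_subproof d (k : 'I_d.+1) n (x : {x : Dhom n d | in_horn k x}) :
  horn_act (did n) x = x.
Proof. by apply/val_inj/sdelta_id_subproof. Qed.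
Fact horn_comp_subproof d (k : 'I_d.+1) l m n (g : Dhom m n) (f : Dhom l m)
    (x : {x : Dhom n d | in_horn k x}) :
  horn_act (dcomp g f) x = horn_act f (horn_act g x).
Proof. by apply/val_inj/sdelta_comp_subproof. Qed.
Definition horn d (k : 'I_d.+1) : sset :=
  @SSet (fun n => {x : Dhom n d | in_horn k x}) (@horn_act d k)
    (@horn_id_subproof d k) (@horn_comp_subproof d k).

Definition horn_incl d (k : 'I_d.+1) : smap (horn k) (sdelta d) :=
  @SMap (horn k) (sdelta d) (fun _ x => val x) (fun _ _ _ _ => erefl).

(* The edge {0,1} of the 0-th horn and the edge {d-1,d} of the d-th horn,
   for d = n + 2. *)
Fact horn_first_subproof n : in_horn (ord0 : 'I_n.+3) (dspine ord0).
Proof.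
apply/existsP; exists ord_max; rewrite -val_eqE /=.
by apply/forallP => i; rewrite ffunE -val_eqE; case: ifP.
Qed.
Definition horn_first n : horn (ord0 : 'I_n.+3) 1 :=
  exist _ (dspine ord0) (horn_first_subproof n).

Fact horn_last_subproof n : in_horn (ord_max : 'I_n.+3) (dspine ord_max).
Proof.
apply/existsP; exists ord0; rewrite -val_eqE /=.
by apply/forallP => i; rewrite ffunE -val_eqE; case: ifP.
Qed.
Definition horn_last n : horn (ord_max : 'I_n.+3) 1 :=
  exist _ (dspine ord_max) (horn_last_subproof n).

Definition quasicategory (X : sset) : Prop :=
  forall d (k : 'I_d.+1), 0 < k < d ->
  forall a : smap (horn k) X,
  exists l : smap (sdelta d) X, l \os horn_incl k = a.

Definition inner_fibration (X S : sset) (p : smap X S) : Prop :=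
  forall d (k : 'I_d.+1), 0 < k < d ->
  forall (a : smap (horn k) X) (b : smap (sdelta d) S),
    p \os a = b \os horn_incl k ->
  exists l : smap (sdelta d) X, l \os horn_incl k = a /\ p \os l = b.

(* Outer-horn form of (co)cartesian edges; the edge is the first edge of the
   0-th horn, resp. the last edge of the d-th horn, for all d = n + 2 >= 2. *)
Definition cocartesian_edge (X S : sset) (p : smap X S) (e : X 1) : Prop :=
  forall n (a : smap (horn (ord0 : 'I_n.+3)) X) (b : smap (sdelta n.+2) S),
    p \os a = b \os horn_incl ord0 -> a 1 (horn_first n) = e ->
  exists l : smap (sdelta n.+2) X, l \os horn_incl ord0 = a /\ p \os l = b.

Definition cartesian_edge (X S : sset) (p : smap X S) (e : X 1) : Prop :=
  forall n (a : smap (horn (ord_max : 'I_n.+3)) X) (b : smap (sdelta n.+2) S),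
    p \os a = b \os horn_incl ord_max -> a 1 (horn_last n) = e ->
  exists l : smap (sdelta n.+2) X, l \os horn_incl ord_max = a /\ p \os l = b.

Definition cocartesian_fibration (X S : sset) (p : smap X S) : Prop :=
  inner_fibration p /\
  forall (h : S 1) (x : X 0), p 0 x = source h ->
  exists e : X 1, [/\ cocartesian_edge p e, source e = x & p 1 e = h].

Definition cartesian_fibration (X S : sset) (p : smap X S) : Prop :=
  inner_fibration p /\
  forall (h : S 1) (y : X 0), p 0 y = target h ->
  exists e : X 1, [/\ cartesian_edge p e, target e = y & p 1 e = h].

Fact sfun_id_subproof (K X : sset) n (h : smap (K \xs sdelta n) X) :
  h \os sprod_map (smap_id K) (sdelta_map (did n)) = h.
Proof.
apply: smap_ext => m [x t] /=; congr (h m (x, _)).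
by apply: Dhom_ext => i; rewrite !ffunE.
Qed.
Fact sfun_comp_subproof (K X : sset) k m n (g : Dhom m n) (f : Dhom k m)
    (h : smap (K \xs sdelta n) X) :
  h \os sprod_map (smap_id K) (sdelta_map (dcomp g f)) =
  h \os sprod_map (smap_id K) (sdelta_map g)
    \os sprod_map (smap_id K) (sdelta_map f).
Proof.
apply: smap_ext => j [x t] /=; congr (h j (x, _)).
by apply: Dhom_ext => i; rewrite !ffunE.
Qed.
(* Fun(K, X), with n-simplices the maps K x Delta^n -> X. *)
Definition sfun (K X : sset) : sset :=
  @SSet (fun n => smap (K \xs sdelta n) X)
    (fun m n phi h => h \os sprod_map (smap_id K) (sdelta_map phi))
    (@sfun_id_subproof K X) (@sfun_comp_subproof K X).

Definition sfun_vertex (K X : sset) (a : smap K X) : sfun K X 0 :=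
  a \os sfst K (sdelta 0).

(* [composite f g h] says that h is a composite of f followed by g. *)
Definition composite (X : sset) (f g h : X 1) : Prop :=
  exists s : X 2, [/\ sact (dface (inord 2)) s = f,
                      sact (dface (inord 0)) s = g &
                      sact (dface (inord 1)) s = h].

Definition homotopic (X : sset) (f f' : X 1) : Prop :=
  composite f (id_edge (target f)) f'.

(* For a quasicategory X this says that the class of f is invertible in the
   homotopy category: there is g such that the classes of the composites of f
   and g, in both orders, are those of the identity edges. *)
Definition equivalence_edge (X : sset) (f : X 1) : Prop :=
  exists g gf fg : X 1,
    [/\ composite f g gf, homotopic gf (id_edge (source f)),
        composite g f fg & homotopic fg (id_edge (target f))].

Definition equivalent_objects (X : sset) (x y : X 0) : Prop :=
  exists e : X 1, [/\ source e = x, target e = y & equivalence_edge e].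

Definition equivalent_functors (K X : sset) (a b : smap K X) : Prop :=
  equivalent_objects (sfun_vertex a) (sfun_vertex b).

Notation I01 := (sdelta 1).

Definition in_fiber (K : sset) (s : smap K I01) (b : 'I_2) n (x : K n) : bool :=
  s n x == dconst n b.

Fact in_fiber_act (K : sset) (s : smap K I01) (b : 'I_2) m n (phi : Dhom m n)
    (x : K n) : in_fiber s b x -> in_fiber s b (sact phi x).
Proof.
move=> /eqP sx; rewrite /in_fiber sapp_nat sx; apply/eqP.
by apply: Dhom_ext => i; rewrite !ffunE.
Qed.

Definition fiber_act (K : sset) (s : smap K I01) (b : 'I_2) m n
    (phi : Dhom m n) (x : {x : K n | in_fiber s b x}) :
    {x : K m | in_fiber s b x} :=
  exist _ (sact phi (sval x)) (in_fiber_act phi (svalP x)).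

Lemma fiber_inj (K : sset) (s : smap K I01) (b : 'I_2) n
    (x y : {x : K n | in_fiber s b x}) : sval x = sval y -> x = y.
Proof.
case: x y => [x px] [y py] /= xy; subst y.
by rewrite (bool_irrelevance px py).
Qed.

Fact fiber_id_subproof (K : sset) (s : smap K I01) (b : 'I_2) n
    (x : {x : K n | in_fiber s b x}) : fiber_act (did n) x = x.
Proof. by apply/fiber_inj/sact_id. Qed.
Fact fiber_comp_subproof (K : sset) (s : smap K I01) (b : 'I_2) k m n
    (g : Dhom m n) (f : Dhom k m) (x : {x : K n | in_fiber s b x}) :
  fiber_act (dcomp g f) x = fiber_act f (fiber_act g x).
Proof. by apply/fiber_inj/sact_comp. Qed.
Definition fiber (K : sset) (s : smap K I01) (b : 'I_2) : sset :=
  @SSet (fun n => {x : K n | in_fiber s b x}) (@fiber_act K s b)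
    (@fiber_id_subproof K s b) (@fiber_comp_subproof K s b).

Definition fiber_incl (K : sset) (s : smap K I01) (b : 'I_2) :
    smap (fiber s b) K :=
  @SMap (fiber s b) K (fun _ x => sval x) (fun _ _ _ _ => erefl).

Definition fiber_fun (K' K : sset) (i : smap K' K) (s : smap K I01) (b : 'I_2)
    n (x : fiber (s \os i) b n) : fiber s b n :=
  exist _ (i n (sval x)) (svalP x).
Fact fiber_map_subproof (K' K : sset) (i : smap K' K) (s : smap K I01)
    (b : 'I_2) m n (phi : Dhom m n) (x : fiber (s \os i) b n) :
  fiber_fun (sact phi x) = sact phi (fiber_fun x).
Proof. by apply/fiber_inj/sapp_nat. Qed.
(* The map induced by i on the fibers of s o i and s over {b}. *)
Definition fiber_map (K' K : sset) (i : smap K' K) (s : smap K I01) (b : 'I_2) :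
    smap (fiber (s \os i) b) (fiber s b) :=
  @SMap (fiber (s \os i) b) (fiber s b) (@fiber_fun K' K i s b)
    (@fiber_map_subproof K' K i s b).

Fact at_end_subproof (K : sset) (b : 'I_2) m n (phi : Dhom m n) (x : K n) :
  (sact phi x, dconst m b) = sact phi ((x, dconst n b) : (K \xs I01) n).
Proof. by congr (_, _); apply: Dhom_ext => i; rewrite !ffunE. Qed.
(* The inclusion of K = K x {b} into K x Delta^1. *)
Definition at_end (K : sset) (b : 'I_2) : smap K (K \xs I01) :=
  @SMap K (K \xs I01) (fun n x => (x, dconst n b)) (@at_end_subproof K b).

Definition end0 : 'I_2 := ord0.
Definition end1 : 'I_2 := ord_max.

Definition adjunction (M : sset) (p : smap M I01) : Prop :=
  [/\ quasicategory M, cartesian_fibration p & cocartesian_fibration p].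

(* The edge u|{c} x Delta^1. *)
Definition edge_at (C M : sset) (u : smap (C \xs I01) M) (c : C 0) : M 1 :=
  u 1 (id_edge c, did 1).

(* iC and iD are the chosen identifications of C and D with the fibers of p. *)
Record associated (M C D : sset) (p : smap M I01)
    (iC : smap C (fiber p end0)) (iD : smap D (fiber p end1))
    (f : smap C D) (g : smap D C)
    (u : smap (C \xs I01) M) (v : smap (D \xs I01) M) : Prop := Associated {
  assoc_u_over : p \os u = ssnd C I01;
  assoc_u0 : u \os at_end C end0 = fiber_incl p end0 \os iC;
  assoc_u1 : u \os at_end C end1 = fiber_incl p end1 \os iD \os f;
  assoc_u_cocart : forall c : C 0, cocartesian_edge p (edge_at u c);
  assoc_v_over : p \os v = ssnd D I01;
  assoc_v1 : v \os at_end D end1 = fiber_incl p end1 \os iD;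
  assoc_v0 : v \os at_end D end0 = fiber_incl p end0 \os iC \os g;
  assoc_v_cart : forall d : D 0, cartesian_edge p (edge_at v d) }.

Definition adjunct (M C D : sset) (p : smap M I01)
    (iC : smap C (fiber p end0)) (iD : smap D (fiber p end1))
    (u : smap (C \xs I01) M) (v : smap (D \xs I01) M)
    (K : sset) (s : smap K I01) (a : smap K C) (ta : smap K D) : Prop :=
  exists A : smap (K \xs I01) M,
    p \os A = ssnd K I01 /\
    [/\ A \os at_end K end0 = fiber_incl p end0 \os iC \os a,
        A \os at_end K end1 = fiber_incl p end1 \os iD \os ta,
        A \os sprod_map (fiber_incl s end0) (smap_id I01) =
          u \os sprod_map a (smap_id I01)
            \os sprod_map (fiber_incl s end0) (smap_id I01) &
        A \os sprod_map (fiber_incl s end1) (smap_id I01) =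
          v \os sprod_map ta (smap_id I01)
            \os sprod_map (fiber_incl s end1) (smap_id I01)].

(* Main.v *)
(* The map A is built simplex by simplex, on the simplices of K outside K_0 and
   K': such a simplex has its first vertex c in K_0, and its prism, prescribed
   over {0} and over the boundary, is filled by inner horns and one last left
   outer horn whose first edge is the cocartesian edge of u at c.  For
   uniqueness, the same extension property is applied to K x J, with J the nerve
   of the contractible groupoid on two objects, relative to the two given maps
   on K x {0,1} and to the constant homotopy on the fibers of K, where these
   maps agree.  The result, restricted to the end over 1, is a map from K x J
   to D, that is, an equivalence in Fun(K, D). *)
Require Import Defs.
From mathcomp Require Import all_boot boolp classical_sets zify.

Set Implicit Arguments.
Unset Strict Implicit.
Unset Printing Implicit Defensive.

Local Open Scope nat_scope.
Local Open Scope sset_scope.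

(** * Monotone maps, boundaries and horns *)

Lemma Dhom_homo m n (phi : Dhom m n) (i j : 'I_m.+1) :
  i <= j -> phi i <= phi j.
Proof. exact: (monotoneP _ (dfun_monotone phi)). Qed.

Lemma dcompA k l m n (h : Dhom m n) (g : Dhom l m) (f : Dhom k l) :
  dcomp (dcomp h g) f = dcomp h (dcomp g f).
Proof. by apply: Dhom_ext => i; rewrite !ffunE. Qed.

Lemma dcomp_id m n (phi : Dhom m n) : dcomp phi (did m) = phi.
Proof. by apply: Dhom_ext => i; rewrite !ffunE. Qed.

Lemma did_comp m n (phi : Dhom m n) : dcomp (did n) phi = phi.
Proof. by apply: Dhom_ext => i; rewrite !ffunE. Qed.

Lemma dconst_comp k m n (phi : Dhom k m) (b : 'I_n.+1) :
  dcomp (dconst m b) phi = dconst k b.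
Proof. by apply: Dhom_ext => i; rewrite !ffunE. Qed.

Definition in_boundary m n (phi : Dhom m n) : bool :=
  [exists j, [forall i, phi i != j]].

Lemma in_boundary_comp k m n (phi : Dhom m n) (psi : Dhom k m) :
  in_boundary phi -> in_boundary (dcomp phi psi).
Proof.
case/existsP=> j /forallP Hj; apply/existsP; exists j; apply/forallP=> i.
by rewrite ffunE.
Qed.

Lemma in_boundaryPn m n (phi : Dhom m n) :
  reflect (forall j, exists i, phi i = j) (~~ in_boundary phi).
Proof.
rewrite negb_exists; apply: (iffP forallP) => H j.
  by have := H j; rewrite negb_forall => /existsP[i /negPn/eqP]; exists i.
by rewrite negb_forall; have [i Hi] := H j; apply/existsP; exists i; rewrite Hi eqxx.
Qed.

Lemma in_boundary_vertex n (phi : Dhom 0 n.+1) : in_boundary phi.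
Proof.
have [//|/in_boundaryPn H] := boolP (in_boundary phi).
have [i Hi] := H ord0; have [j Hj] := H ord_max.
by move: Hi Hj; rewrite !ord1 => -> /(congr1 val).
Qed.

Lemma in_boundary_dim0 m (phi : Dhom m 0) : ~~ in_boundary phi.
Proof. by apply/in_boundaryPn => j; exists ord0; rewrite !ord1. Qed.

Lemma in_boundary_factor m n (phi : Dhom m n.+1) :
  in_boundary phi -> exists j (psi : Dhom m n), phi = dcomp (dface j) psi.
Proof.
case/existsP=> j /forallP Hj; exists j.
have Hlt i : unbump j (phi i) < n.+1.
  have := unlift_subproof (exist (fun i => i != j) (phi i) (Hj i)).
  by [].
have mono : monotone [ffun i => Ordinal (Hlt i)].
  apply/monotoneP => a b ab; rewrite !ffunE /= -leq_bump unbumpK ?inE //.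
    exact: Dhom_homo.
  by have := Hj b; rewrite -val_eqE.
exists (DHom mono); apply: Dhom_ext => i; apply: val_inj.
rewrite !ffunE /= unbumpK ?inE //.
by have := Hj i; rewrite -val_eqE.
Qed.

(** Here and in [in_hornP], missed vertices become inequalities of natural numbers, the form that
    [lia] handles. *)
Lemma in_boundaryP m l (phi : Dhom m l) :
  reflect (exists j : 'I_l.+1, forall i : 'I_m.+1, phi i <> j :> nat)
          (in_boundary phi).
Proof.
apply: (iffP existsP) => -[j Hj]; exists j.
  by move=> i; apply/eqP; move/forallP: Hj => /(_ i); rewrite -val_eqE.
by apply/forallP => i; rewrite -val_eqE; apply/eqP/Hj.
Qed.

Lemma in_hornP m l (k : 'I_l.+1) (phi : Dhom m l) :
  reflect (exists j : 'I_l.+1, j <> k :> nat /\ forall i : 'I_m.+1, phi i <> j :> nat)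
          (in_horn k phi).
Proof.
apply: (iffP existsP) => -[j].
  rewrite -val_eqE => /andP[/eqP jk /forallP Hj]; exists j; split=> // i.
  by apply/eqP; have := Hj i; rewrite -val_eqE.
move=> [/eqP jk Hj]; exists j; rewrite -val_eqE jk.
by apply/forallP => i; rewrite -val_eqE; apply/eqP/Hj.
Qed.

(** Any set-theoretic section of a monotone surjection is monotone, so its value at [phi i0] may be
    chosen to be [i0]. *)
Lemma section_through m n (phi : Dhom m n) (i0 : 'I_m.+1) :
  ~~ in_boundary phi ->
  exists delta : Dhom n m, dcomp phi delta = did n /\ delta (phi i0) = i0.
Proof.
move/in_boundaryPn => H.
pose del := [ffun j => if j == phi i0 then i0 else sval (cid (H j))].
have delK j : phi (del j) = j.
  rewrite /del ffunE; case: eqP => [->//|_]; by case: cid.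
have mono : monotone del.
  apply/monotoneP => i j; rewrite leq_eqVlt => /orP[/eqP/val_inj->//|ij].
  rewrite leqNgt; apply/negP => /ltnW /(Dhom_homo phi).
  by rewrite !delK leqNgt ij.
exists (DHom mono); split; last by rewrite /= ffunE eqxx.
by apply: Dhom_ext => j; rewrite [LHS]ffunE /= delK ffunE.
Qed.

(** An injective monotone map is strictly increasing: counting up from 0 gives [i <= theta i], and
    counting down from [n] gives [theta i <= i]. *)
Lemma injective_Dhom n (theta : Dhom n n) : injective theta -> theta = did n.
Proof.
move=> inj.
have lo (k : nat) (i : 'I_n.+1) : k = i -> k <= theta i.
  elim: k i => // k IH i ki; have kn : k < n.+1 by rewrite ltnW // ki.
  apply: leq_ltn_trans (IH (Ordinal kn) erefl) _.
  rewrite ltn_neqAle Dhom_homo ?andbT /= -?ki // val_eqE.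
  by apply/eqP => /inj /(congr1 val) /= E; move: ki; rewrite -E => /eqP; rewrite eqn_leq ltnn.
have hi (k : nat) (i : 'I_n.+1) : k + i = n -> theta i + k <= n.
  elim: k i => [|k IH] i ki; first by rewrite addn0 -ltnS.
  have kn : i.+1 < n.+1 by rewrite ltnS (leq_trans _ (eq_leq ki)) // addSn ltnS leq_addl.
  apply: leq_trans (IH (Ordinal kn) _); last by rewrite /= addnS -addSn.
  rewrite addnS -addSn leq_add2r.
  rewrite ltn_neqAle Dhom_homo ?andbT //= val_eqE.
  by apply/eqP => /inj /(congr1 val) /= /eqP; rewrite eqn_leq ltnn andbF.
apply: Dhom_ext => i; apply/val_inj; rewrite /= ffunE; apply/eqP.
rewrite eqn_leq (lo i i) // andbT.
have ni : i <= n by rewrite -ltnS.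
by rewrite -(leq_add2r (n - i)) subnKC // hi // subnK.
Qed.

(** A section of [theta] is injective, hence the identity, and then so is [theta]. *)
Lemma surjective_Dhom n (theta : Dhom n n) : ~~ in_boundary theta -> theta = did n.
Proof.
move=> H; apply: injective_Dhom => i j ij.
have [d [dK di]] := section_through i H; have [_ dj] := (dK, di).
have inj : injective d.
  move=> a b ab; have := congr1 (fun f : Dhom n n => f a) dK.
  have := congr1 (fun f : Dhom n n => f b) dK; by rewrite !ffunE ab => -> ->.
have E := injective_Dhom inj; move: dK; rewrite E dcomp_id => Et.
by move: ij; rewrite Et !ffunE.
Qed.

(** * Simplicial maps defined on subcomplexes, as relations *)

Lemma smap_app (X Y : sset) (f g : smap X Y) :
  f = g -> forall n (x : X n), f n x = g n x.
Proof. by move=> ->. Qed.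
Arguments smap_app {X Y f g} _ n x.

(** A stable functional graph is a simplicial map defined on the subcomplex [dom G]. The relational
    form lets domains grow, overlap and be united without a type for each subcomplex. *)
Definition graph (X Y : sset) := forall n, X n -> Y n -> Prop.

Definition dom (X Y : sset) (G : graph X Y) n (x : X n) : Prop :=
  exists y, G n x y.

Definition stable (X Y : sset) (G : graph X Y) : Prop :=
  forall m n (phi : Dhom m n) x y, G n x y -> G m (sact phi x) (sact phi y).

Definition functional (X Y : sset) (G : graph X Y) : Prop :=
  forall n x y y', G n x y -> G n x y' -> y = y'.

Definition gsub (X Y : sset) (G H : graph X Y) : Prop :=
  forall n x y, G n x y -> H n x y.

Lemma smap_of_graph (X Y : sset) (G : graph X Y) :
  stable G -> functional G -> (forall n (x : X n), dom G x) ->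
  exists f : smap X Y, forall n (x : X n), G n x (f n x).
Proof.
move=> Gs Gf Gt; pose F n (x : X n) := sval (cid (Gt n x)).
have FP n x : G n x (F n x) by rewrite /F; case: cid.
have Fnat m n (phi : Dhom m n) x : F m (sact phi x) = sact phi (F n x).
  exact: Gf (FP _ _) (Gs _ _ _ _ _ (FP _ _)).
by exists (SMap Fnat).
Qed.

(* The Eilenberg-Zilber argument: if x phi = x psi with phi and psi surjective,
   every section of phi is a section of psi, since otherwise x would be x theta
   with theta not surjective. *)
Lemma surjection_unique (X : sset) (P : forall n, X n -> Prop) n (x : X n)
    m (phi psi : Dhom m n) :
  ~ P n x -> (forall theta : Dhom n n, in_boundary theta -> P n (sact theta x)) ->
  ~~ in_boundary phi -> sact phi x = sact psi x -> phi = psi.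
Proof.
move=> nPx Pb Hphi E; apply: Dhom_ext => i.
have [d [dK di]] := section_through i Hphi.
have Ex : x = sact (dcomp psi d) x.
  by rewrite sact_comp -E -sact_comp dK sact_id.
have : dcomp psi d = did n.
  apply: surjective_Dhom; apply/negP => /Pb; rewrite -Ex; exact: nPx.
move=> /(congr1 (fun f : Dhom n n => f (phi i))).
by rewrite !ffunE di => ->.
Qed.

(** * Extension cell by cell, by Zorn's lemma *)

Section CellExtension.
Variables (K X : sset) (R G0 : graph K X).
Hypotheses (R_stable : stable R) (G0_stable : stable G0).
Hypotheses (G0_functional : functional G0) (G0R : gsub G0 R).
Hypothesis fill : forall (G : graph K X), stable G -> functional G ->
  gsub G R -> gsub G0 G -> forall n (x : K n), ~ dom G x ->
  (forall m (phi : Dhom m n), in_boundary phi -> dom G (sact phi x)) ->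
  exists y : X n, R x y /\
    forall m (phi : Dhom m n), in_boundary phi -> G m (sact phi x) (sact phi y).

Definition attach (G : graph K X) n (x : K n) (y : X n) : graph K X :=
  fun m z w => G m z w \/ exists phi : Dhom m n, z = sact phi x /\ w = sact phi y.

Lemma attach_stable G n (x : K n) (y : X n) :
  stable G -> stable (attach G x y).
Proof.
move=> Gs k m psi z w [Gzw|[phi [-> ->]]]; first by left; apply: Gs.
by right; exists (dcomp phi psi); rewrite !sact_comp.
Qed.

(** If [G] is defined at [sact phi x], then [phi] is not surjective, since a section of [phi] would
    put [x] in the domain; so old and new values agree by the boundary condition. Two new values at
    one simplex come from the boundary or, by [surjection_unique], from the same surjection. *)
Lemma attach_functional G n (x : K n) (y : X n) :
  stable G -> functional G -> ~ dom G x ->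
  (forall m (phi : Dhom m n), in_boundary phi -> G m (sact phi x) (sact phi y)) ->
  functional (attach G x y).
Proof.
move=> Gs Gf ndx Gb.
have Gsurj m (phi : Dhom m n) w : G m (sact phi x) w -> in_boundary phi.
  move=> Gw; have [//|Hphi] := boolP (in_boundary phi); case: ndx.
  have [d [dK _]] := section_through ord0 Hphi.
  by exists (sact d w); rewrite -[x]sact_id -dK sact_comp; apply: Gs.
have GE m (phi : Dhom m n) w : G m (sact phi x) w -> w = sact phi y.
  by move=> Gw; have Hphi := Gsurj _ _ _ Gw; apply: Gf Gw _; apply: Gb.
move=> m z w w' [Gw|[phi [-> ->]]] [Gw'|[psi [E ->]]].
- exact: Gf Gw Gw'.
- by rewrite E in Gw; apply: GE.
- by symmetry; apply: GE.
- have [Hphi|Hphi] := boolP (in_boundary phi).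
    by apply: GE; rewrite -E; apply: Gb.
  have -> // : phi = psi.
  apply: (@surjection_unique K (fun n x => dom G x) n x) => // theta Ht.
  by exists (sact theta y); apply: Gb.
Qed.

(** A maximal partial map satisfying [R] is total: at a missing simplex of least dimension the
    boundary is already covered, and [fill] would allow one more cell. *)
Lemma cell_extension : exists F : smap K X,
  (forall n (x : K n), R x (F n x)) /\
  (forall n (x : K n) y, G0 x y -> F n x = y).
Proof.
pose T := {n : nat & (K n * X n)%type}.
(* Adding [G0] to every [A] keeps it inside each candidate and makes the empty chain harmless. *)
pose gr (A : set T) : graph K X := fun n x y => A (existT _ n (x, y)) \/ G0 x y.
pose P : set (set T) := fun A => [/\ stable (gr A), functional (gr A) & gsub (gr A) R].
have [] := @Zorn_bigcup T P.
  move=> F FP Ftot; split.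
  - move=> m n phi x y [[A FA Axy]|Gxy]; last by right; apply: G0_stable.
    have [As _ _] := FP A FA; have [|?] := As _ _ phi _ _ (or_introl Axy); last by right.
    by left; exists A.
  - move=> n x y y' [[A FA Axy]|Gxy] [[B FB Bxy]|Gxy'].
    + have [AB|BA] := Ftot A B FA FB.
        have [_ Bf _] := FP B FB; apply: (Bf n x); left => //; exact: AB.
      have [_ Af _] := FP A FA; apply: (Af n x); left => //; exact: BA.
    + by have [_ Af _] := FP A FA; apply: (Af n x); [left|right].
    + by have [_ Bf _] := FP B FB; apply: (Bf n x); [right|left].
    + exact: G0_functional Gxy Gxy'.
  - move=> n x y [[A FA Axy]|Gxy]; last exact: G0R.
    by have [_ _ AR] := FP A FA; apply: AR; left.
move=> A [[As Af AR] Amax].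
have total n (x : K n) : dom (gr A) x.
  elim/ltn_ind: n x => n IH x.
  have [//|ndx] := pselect (dom (gr A) x); exfalso.
  have bd m (phi : Dhom m n) : in_boundary phi -> dom (gr A) (sact phi x).
    case: n IH x ndx phi => [|n] IH x ndx phi.
      by move=> Hb; have := in_boundary_dim0 phi; rewrite Hb.
    move=> /in_boundary_factor[j [psi ->]]; rewrite sact_comp.
    have [y Gy] := IH n (ltnSn n) (sact (dface j) x).
    by exists (sact psi y); apply: As.
  have [] := fill As Af AR _ ndx bd; first by move=> ? ? ?; right.
  move=> y [Rxy Gy].
  pose B : set T := fun t => attach (gr A) x y (projT2 t).1 (projT2 t).2.
  have EB : gr B = attach (gr A) x y.
    apply: functional_extensionality_dep => m; apply/funext => z; apply/funext => w.
    apply/propext; split; first by case=> //; left; right.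
    by left.
  (* [A] is strictly inside [B]: the pair [(x, y)] is in [B], while [x] is outside the domain of
     [gr A]. *)
  apply: (Amax B).
    split; first by case=> m [z w] Azw; left; left.
    move=> /(_ (existT _ n (x, y))) BA; apply: ndx; exists y; left; apply: BA.
    by right; exists (did n); rewrite /= !sact_id.
  split; rewrite EB.
  - exact: attach_stable.
  - exact: attach_functional.
  - by move=> m z w [/AR//|[phi [-> ->]]]; apply: R_stable.
have [F FP] := smap_of_graph As Af total.
exists F; split=> n x; first exact: AR.
by move=> y Gxy; apply: Af (FP n x) _; right.
Qed.

End CellExtension.

(** * Horn filling for graphs *)

Section HornFilling.
Variables (Y M : sset) (p : smap M I01) (b : smap Y I01).

Definition over (G : graph Y M) : Prop := forall n y w, G n y w -> p n w = b n y.

(** This is a pushout along a horn inclusion: as [tau] is injective and meets [dom G] exactly in the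
    horn, the values of the filler are unambiguous and agree with [G]. Lifting is asked only for
    horns read off from [G], so that an outer horn may use its cocartesian first edge. *)
Lemma horn_extension d (k : 'I_d.+1) (tau : smap (sdelta d) Y) (G : graph Y M) :
  is_mono tau -> stable G -> functional G -> over G ->
  (forall n (psi : Dhom n d), dom G (tau n psi) <-> in_horn k psi) ->
  (forall a : smap (horn k) M, (forall n psi, G n (tau n (val psi)) (a n psi)) ->
     p \os a = b \os tau \os horn_incl k ->
     exists l : smap (sdelta d) M, l \os horn_incl k = a /\ p \os l = b \os tau) ->
  exists H : graph Y M, [/\ stable H, functional H, over H & gsub G H /\
    forall n (y : Y n), dom H y <-> dom G y \/ exists psi, y = tau n psi].
Proof.
move=> tau_mono Gs Gf Gp domG lift.
have [] := @smap_of_graph (horn k) M (fun n psi w => G n (tau n (val psi)) w).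
- by move=> m n phi psi w /(Gs _ _ phi); rewrite -sapp_nat.
- by move=> n psi w w'; apply: Gf.
- by move=> n psi; apply/domG/(valP psi).
move=> a Ga; have [|l [la pl]] := lift a Ga.
  by apply: smap_ext => n psi; apply: Gp (Ga n psi).
have Gl n (psi : Dhom n d) w : G n (tau n psi) w -> w = l n psi.
  move=> Gw; have Hpsi : in_horn k psi by apply/domG; exists w.
  have -> : l n psi = a n (exist _ psi Hpsi) by rewrite -la.
  exact: Gf Gw (Ga n (exist _ psi Hpsi)).
exists (fun n y w => G n y w \/ exists psi, y = tau n psi /\ w = l n psi); split.
- move=> m n phi y w [/Gs Gy|[psi [-> ->]]]; first by left; apply: Gy.
  by right; exists (sact phi psi); rewrite !sapp_nat.
- move=> n y w w' [Gw|[psi [Ey ->]]] [Gw'|[psi' [Ey' ->]]].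
  + exact: Gf Gw Gw'.
  + by rewrite Ey' in Gw; apply: Gl.
  + by rewrite Ey in Gw'; symmetry; apply: Gl.
  + by move: Ey'; rewrite Ey => /tau_mono ->.
- move=> n y w [/Gp//|[psi [-> ->]]].
  exact: (smap_app pl n psi).
split; first by move=> n y w; left.
move=> n y; split; first by case=> w [Gw|[psi [-> _]]]; [left; exists w|right; exists psi].
by case=> [[w Gw]|[psi ->]]; [exists w; left|exists (l n psi); right; exists psi].
Qed.

End HornFilling.

(** * Filling a prism shuffle by shuffle *)

Section Prism.
Variable n : nat.
Notation prism := (I01 \xs sdelta n.+1).

Fact shuffle_t_subproof (j : nat) :
  monotone [ffun i : 'I_n.+3 => inord (j < i) : 'I_2].
Proof.
apply/monotoneP => a b ab; by rewrite !ffunE !inordK; lia.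
Qed.

Fact shuffle_x_subproof (j : nat) (jn : j < n.+2) :
  monotone [ffun i : 'I_n.+3 => inord (unbump j i) : 'I_n.+2].
Proof.
apply/monotoneP => a b ab; have ha := ltn_ord a; have hb := ltn_ord b.
rewrite /unbump !ffunE !inordK; lia.
Qed.

(* The nondegenerate (n+2)-simplex
   (0,0), ..., (0,j), (1,j), ..., (1,n+1) of the prism. *)
Definition shuffle (j : nat) (jn : j < n.+2) : prism n.+2 :=
  (DHom (shuffle_t_subproof j), DHom (shuffle_x_subproof jn)).

Fact shuffle_map_subproof (j : nat) (jn : j < n.+2) m l (phi : Dhom m l)
    (psi : sdelta n.+2 l) :
  sact (sact phi psi : Dhom m n.+2) (shuffle jn) =
  sact phi (sact (psi : Dhom l n.+2) (shuffle jn)).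
Proof. by rewrite -sact_comp. Qed.

Definition shuffle_map (j : nat) (jn : j < n.+2) : smap (sdelta n.+2) prism :=
  @SMap (sdelta n.+2) prism (fun m psi => sact (psi : Dhom m n.+2) (shuffle jn))
    (shuffle_map_subproof jn).

Lemma shuffle_tE j (jn : j < n.+2) m (psi : Dhom m n.+2) x :
  (shuffle_map jn m psi).1 x = (j < psi x) :> nat.
Proof. rewrite !ffunE inordK //; lia. Qed.

Lemma shuffle_xE j (jn : j < n.+2) m (psi : Dhom m n.+2) x :
  (shuffle_map jn m psi).2 x = unbump j (psi x) :> nat.
Proof. have px := ltn_ord (psi x); rewrite !ffunE inordK // /unbump; lia. Qed.

(* The two coordinates of a point of a shuffle add up to its position. *)
Lemma shuffle_mono j (jn : j < n.+2) : is_mono (shuffle_map jn).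
Proof.
move=> m a b E; apply: Dhom_ext => x; apply: val_inj => /=.
have := shuffle_xE jn a x; have := shuffle_tE jn a x.
rewrite E shuffle_xE shuffle_tE /unbump; lia.
Qed.

(* The subcomplex generated by the boundary, the end over 0 and the shuffles
   of index at least j. *)
Definition filled (j : nat) m (z : prism m) : Prop :=
  in_boundary z.2 \/ forall x : 'I_m.+1, 0 < z.1 x -> j <= z.2 x.

(** In shuffle [j], the face opposite position [j.+1] has its vertices over 1 at [j.+1] or later,
    and the face opposite a position other than [j] and [j.+1] omits a vertex of the base. Only the
    face opposite [j] is new. *)
Lemma filled_shuffle j (jn : j < n.+2) (k : 'I_n.+3) m (psi : Dhom m n.+2) :
  k = j :> nat -> filled j.+1 (shuffle_map jn m psi) <-> in_horn k psi.
Proof.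
move=> kj; split.
- case=> [/in_boundaryP[i Hi]|H]; apply/in_hornP.
    have lti := ltn_ord i.
    (* The base vertex [j] occupies both positions [j] and [j.+1]; this choice avoids [j], which the
       horn excludes. *)
    exists (inord (if i < j then nat_of_ord i else i.+1)).
    rewrite kj inordK; last by case: ifP; lia.
    split; first by case: ifP; lia.
    by move=> x; have := Hi x; rewrite shuffle_xE /unbump; case: ifP; lia.
  exists (inord j.+1); rewrite kj inordK //; split; first by lia.
  by move=> x; have := H x; rewrite shuffle_xE shuffle_tE /unbump; lia.
move=> /in_hornP[i [ik Hi]]; have lti := ltn_ord i.
have [Ei|Ei] := eqVneq (i : nat) j.+1.
  by right=> x; rewrite shuffle_xE shuffle_tE /unbump; have := Hi x; lia.
left; apply/in_boundaryP; exists (inord (unbump j i)) => x.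
by rewrite shuffle_xE inordK /unbump; have := Hi x; lia.
Qed.

(** A simplex in stage [j] but not in stage [j.+1] has a vertex [(1, j)]. Its vertices over 0 come
    before that one, so their second coordinate is at most [j], which places the whole simplex in
    shuffle [j]. *)
Lemma filledS j (jn : j < n.+2) m (z : prism m) :
  filled j z <-> filled j.+1 z \/ exists psi, z = shuffle_map jn m psi.
Proof.
split; last first.
  case=> [[?|H]|[psi ->]]; first by left.
    by right=> x /H; apply: ltnW.
  by right=> x; rewrite shuffle_xE shuffle_tE /unbump; lia.
case=> [?|Hz]; first by left; left.
have [?|nz] := pselect (filled j.+1 z); [by left|right].
case: z Hz nz => t phi /= Hz nz.
have t2 x : t x < 2 := ltn_ord (t x).
have phin x : phi x < n.+2 := ltn_ord (phi x).
have [x0 [tx0 phix0]] : exists x0, 0 < t x0 /\ phi x0 = j :> nat.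
  have [//|nx] := pselect (exists x0, 0 < t x0 /\ phi x0 = j :> nat).
  case: nz; right=> x /= tx; rewrite ltn_neqAle Hz // andbT.
  by apply/eqP => E; apply: nx; exists x.
(* The position in the shuffle is recovered as the sum of the two coordinates. *)
have mono : monotone [ffun x => inord (phi x + t x) : 'I_n.+3].
  apply/monotoneP => x y xy; have := Dhom_homo phi xy; have := Dhom_homo t xy.
  have := (t2 x, t2 y, phin x, phin y) => -[[[? ?] ?] ?].
  by rewrite !ffunE !inordK; lia.
have psiE x : DHom mono x = phi x + t x :> nat.
  by have := (t2 x, phin x) => -[? ?]; rewrite /= ffunE inordK; lia.
have Hz' x : t x = 0 :> nat -> phi x <= j.
  move=> tx; rewrite -phix0; apply: Dhom_homo; rewrite leqNgt; apply/negP => /ltnW.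
  by move=> /(Dhom_homo t); rewrite tx; lia.
exists (DHom mono); congr (_, _); apply: Dhom_ext => x; apply: val_inj.
  have := shuffle_tE jn (DHom mono) x; rewrite /= psiE => ->.
  have := (t2 x, Hz x, Hz' x) => -[[]]; lia.
have := shuffle_xE jn (DHom mono) x; rewrite /= psiE => ->.
have := (t2 x, Hz x, Hz' x) => -[[]]; rewrite /unbump; lia.
Qed.

(** Shuffles are attached for [j] from [n.+1] down to 0, shuffle [j] along the [j]-th horn of
    dimension [n.+2]. This horn is inner until [j = 0]; its first edge is then the one over vertex 0
    of the base, which is cocartesian. *)
Lemma prism_extension (M : sset) (p : smap M I01) (G : graph prism M) :
  inner_fibration p -> stable G -> functional G ->
  over p (sfst I01 (sdelta n.+1)) G ->
  (forall m (z : prism m), dom G z <-> in_boundary z.2 \/ z.1 = dconst m end0) ->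
  (forall e, G 1 (did 1, dconst 1 ord0) e -> cocartesian_edge p e) ->
  exists h : smap prism M, p \os h = sfst I01 (sdelta n.+1) /\
    forall m z w, G m z w -> h m z = w.
Proof.
move=> p_inner Gs Gf Gp domG cocart.
set b := sfst I01 (sdelta n.+1) in Gp *.
have fill q j : q + j = n.+2 -> exists H : graph prism M,
    [/\ stable H, functional H, over p b H & gsub G H /\
    forall m (z : prism m), dom H z <-> filled j z].
  elim: q j => [|q IH] j.
    (* Second coordinates are at most [n.+1], so at [j = n.+2] the second alternative of [filled]
       says that no vertex lies over 1. *)
    rewrite add0n => ->; exists G; split=> //; split=> // m z; rewrite domG /filled.
    split=> -[?|Hz]; [by left| |by left|]; right.
      by move=> x; rewrite Hz ffunE.
    have z0 (x : 'I_m.+1) : z.1 x = 0 :> nat.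
      by have := (Hz x, ltn_ord (z.1 x), ltn_ord (z.2 x)) => -[[]]; lia.
    by apply: Dhom_ext => x; apply: val_inj; rewrite /= ffunE /= z0.
  rewrite addSnnS => Ej; have [H [Hs Hf Hp [GH domH]]] := IH _ Ej.
  have jn : j < n.+2 by lia.
  pose k : 'I_n.+3 := Ordinal (ltnW jn : j < n.+3).
  have [] := @horn_extension _ M p b _ k (shuffle_map jn) H (@shuffle_mono j jn) Hs Hf Hp.
  - by move=> m psi; rewrite domH; apply: filled_shuffle.
  - move=> a Ha pa; have [j0|j0] := posnP j; last first.
      by apply: p_inner => //=; lia.
    have k0 : k = ord0 by apply: val_inj.
    move: a Ha pa; rewrite k0 => a Ha pa.
    apply: (@cocart (a 1 (horn_first n)) _ n a) => //.
    have := Ha 1 (horn_first n).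
    have -> : shuffle_map jn 1 (val (horn_first n)) = (did 1, dconst 1 ord0).
      congr (_, _); apply: Dhom_ext => x; apply: val_inj.
        have := shuffle_tE jn (dspine ord0) x; rewrite /= => ->.
        by rewrite j0 !ffunE; case: x => [[|[|]]].
      have := shuffle_xE jn (dspine ord0) x; rewrite /= => ->.
      by rewrite j0 !ffunE /unbump; case: x => [[|[|]]].
    (* The base has a further vertex, so this edge lies over the boundary and its value is that of
       [G]. *)
    have [e Ge] : dom G ((did 1, dconst 1 ord0) : prism 1).
      apply/domG; left; apply/existsP; exists ord_max; apply/forallP => /= x.
      by rewrite ffunE.
    by move=> Hw; rewrite (Hf _ _ _ _ Hw (GH _ _ _ Ge)).
  move=> H' [H's H'f H'p [HH' domH']]; exists H'; split=> //; split.
    by move=> m z w /GH /HH'.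
  by move=> m z; rewrite domH' domH (filledS jn).
(* Stage 0 is the whole prism. *)
have [H [Hs Hf Hp [GH domH]]] := fill n.+2 0 (addn0 _).
have [|h hP] := smap_of_graph Hs Hf; first by move=> m z; apply/domH; right.
exists h; split; first by apply: smap_ext => m z; apply: Hp (hP _ _).
by move=> m z w /GH; apply: Hf.
Qed.

End Prism.

(** * Transposition between maps on [K \xs I01] and maps to [sfun I01 M] *)

Section Transpose.
Variables (K M : sset) (A : smap (K \xs I01) M).

Fact transpose_app_subproof n (x : K n) k m (psi : Dhom k m)
    (z : (I01 \xs sdelta n) m) :
  A k (sact (sact psi z).2 x, (sact psi z).1) =
  sact psi (A m (sact (z.2 : Dhom m n) x, z.1)).
Proof. by rewrite -sapp_nat /= -sact_comp. Qed.

(** In this form all data over a simplex [x] is a single value, a prism in [M], so maps on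
    [K \xs I01] can be extended along the simplices of [K]. *)
Definition transpose_app n (x : K n) : sfun I01 M n :=
  @SMap (I01 \xs sdelta n) M
    (fun m z => A m (sact (z.2 : Dhom m n) x, z.1)) (transpose_app_subproof x).

Fact transpose_subproof m n (phi : Dhom m n) (x : K n) :
  transpose_app (sact phi x) = sact phi (transpose_app x).
Proof. by apply: smap_ext => k [t psi]; rewrite /= sact_comp. Qed.

Definition transpose : smap K (sfun I01 M) :=
  @SMap K (sfun I01 M) transpose_app transpose_subproof.

End Transpose.

Section Untranspose.
Variables (K M : sset) (F : smap K (sfun I01 M)).

Fact untranspose_subproof m n (phi : Dhom m n) (z : (K \xs I01) n) :
  F m (sact phi z).1 m ((sact phi z).2, did m) =
  sact phi (F n z.1 n (z.2, did n)).
Proof. by rewrite /= (sapp_nat F) -[RHS]sapp_nat /= dcomp_id did_comp. Qed.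

Definition untranspose : smap (K \xs I01) M :=
  @SMap (K \xs I01) M (fun n z => F n z.1 n (z.2, did n)) untranspose_subproof.

End Untranspose.

(** * Extension of prisms relative to a partial map *)

Section RelativeExtension.
Variables (M : sset) (p : smap M I01) (K : sset) (a0 : smap K M) (Q : K 0 -> Prop).

(** This is the constraint [R] given to [cell_extension]. The last clause keeps the edges over
    vertices in [Q] cocartesian, so that they can start the outer horns of higher cells. *)
Definition admissible : graph K (sfun I01 M) := fun n x y =>
  [/\ p \os y = sfst I01 (sdelta n),
      forall m (phi : Dhom m n), y m (dconst m end0, phi) = a0 m (sact phi x) &
      forall phi : Dhom 0 n, Q (sact phi x) ->
        cocartesian_edge p (y 1 (did 1, dcomp phi (dconst 1 ord0)))].

Lemma admissible_stable : stable admissible.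
Proof.
move=> m n psi x y [py y0 yc]; split.
- apply: smap_ext => k [t phi] /=.
  exact: (smap_app py k (t, dcomp psi phi)).
- by move=> k phi /=; rewrite y0 sact_comp.
- by move=> phi; rewrite -sact_comp => /yc; rewrite /= dcompA.
Qed.

Lemma transpose_admissible (L : sset) (i : smap L K) (A : smap (L \xs I01) M)
    n (x : L n) :
  p \os A = ssnd L I01 -> A \os at_end L end0 = a0 \os i ->
  (forall k : L 0, Q (i 0 k) -> cocartesian_edge p (edge_at A k)) ->
  admissible (i n x) (transpose A n x).
Proof.
move=> pA A0 Ac; split.
- apply: smap_ext => m [t phi] /=.
  exact: (smap_app pA m (sact phi x, t)).
- move=> m phi /=; rewrite -sapp_nat.
  exact: (smap_app A0 m (sact phi x)).
- by move=> phi; rewrite -sapp_nat => /Ac; rewrite /= sact_comp.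
Qed.

Hypothesis p_inner : inner_fibration p.
Hypothesis a0_over : forall n (x : K n), p n (a0 n x) = dconst n end0.

Section Fill.
Variables (G : graph K (sfun I01 M)) (n : nat) (x : K n.+1).
Hypotheses (Gs : stable G) (Gf : functional G) (GR : gsub G admissible).
Hypothesis domG :
  forall m (phi : Dhom m n.+1), in_boundary phi -> dom G (sact phi x).

(** This is what is known of the prism over a new cell [x]. A simplex [(t, phi)] is read off from
    the prism that [G] assigns to [sact phi x], at [(t, did m)]. *)
Definition partial_prism : graph (I01 \xs sdelta n.+1) M := fun m z w =>
  (in_boundary z.2 /\
     exists y : sfun I01 M m, @G m (sact (z.2 : Dhom m n.+1) x) y /\ w = y m (z.1, did m)) \/
  (z.1 = dconst m end0 /\ w = a0 m (sact (z.2 : Dhom m n.+1) x)).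

Lemma partial_prism_stable : stable partial_prism.
Proof.
move=> k m psi [t phi] w [[/= bphi [y [Gy ->]]]|[/= -> ->]].
  left; split; first exact: in_boundary_comp.
  exists (@sact (sfun I01 M) _ _ psi y); split; first by rewrite sact_comp; apply: Gs.
  by rewrite -sapp_nat /= dcomp_id did_comp.
by right; split; [rewrite /= dconst_comp|rewrite /= sact_comp -sapp_nat].
Qed.

Lemma partial_prism_functional : functional partial_prism.
Proof.
have E m (t : I01 m) (phi : Dhom m n.+1) y : @G m (sact phi x) y ->
    t = dconst m end0 -> y m (t, did m) = a0 m (sact phi x).
  by move=> /GR[_ y0 _] ->; rewrite y0 sact_id.
move=> m [t phi] w w' [[/= _ [y [Gy ->]]]|[/= Et ->]] [[/= _ [y' [Gy' ->]]]|[/= Et' ->]] //.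
- by rewrite (Gf Gy Gy').
- exact: E.
- by symmetry; apply: E.
Qed.

Lemma partial_prism_over : over p (sfst I01 (sdelta n.+1)) partial_prism.
Proof.
move=> m [t phi] w [[/= _ [y [/GR[py _ _] ->]]]|[/= -> ->]]; last exact: a0_over.
exact: (smap_app py m (t, did m)).
Qed.

Lemma partial_prism_vertex (phi : Dhom 0 n.+1) y :
  @G 0 (sact phi x) y ->
  partial_prism ((did 1, dcomp phi (dconst 1 ord0)) : (I01 \xs sdelta n.+1) 1)
    (y 1 (did 1, dconst 1 ord0)).
Proof.
move=> Gy; left; split; first by rewrite in_boundary_comp // in_boundary_vertex.
(* The edge lies over the degenerate 1-simplex at the vertex [phi], hence the degenerate prism on
   [y]. *)
exists (@sact (sfun I01 M) _ _ (dconst 1 ord0) y); split; first by rewrite sact_comp; apply: Gs.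
by rewrite /= dcomp_id.
Qed.

Lemma vertex_cocartesian (phi : Dhom 0 n.+1) :
  Q (sact phi x) -> forall e,
  partial_prism ((did 1, dcomp phi (dconst 1 ord0)) : (I01 \xs sdelta n.+1) 1) e ->
  cocartesian_edge p e.
Proof.
move=> Qx e Pe; have [y Gy] := domG (in_boundary_vertex phi).
rewrite (partial_prism_functional Pe (partial_prism_vertex Gy)).
have [_ _ yc] := GR Gy.
by have := yc (did 0); rewrite sact_id did_comp; apply.
Qed.

(** Every vertex of a cell of positive dimension lies in its boundary, so the edges over vertices
    are already given by [G], with their cocartesian property on [Q]. At the first vertex this is
    what [prism_extension] requires. *)
Lemma admissible_filler : Q (vertex x ord0) ->
  exists y : sfun I01 M n.+1, admissible x y /\
    forall m (phi : Dhom m n.+1), in_boundary phi -> @G m (sact phi x) (sact phi y).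
Proof.
move=> Qx.
have [] := @prism_extension n M p partial_prism p_inner partial_prism_stable
  partial_prism_functional partial_prism_over.
- move=> m [t phi]; split=> [[w [[bphi _]|[-> _]]]|[bphi|Et]]; [by left|by right| |].
    by have [y Gy] := domG bphi; exists (y m (t, did m)); left; split=> //; exists y.
  by exists (a0 m (sact phi x)); right.
- move=> e; have <- : dcomp (dconst 0 ord0 : Dhom 0 n.+1) (dconst 1 ord0) = dconst 1 ord0.
    by rewrite dconst_comp.
  exact: vertex_cocartesian.
move=> h [ph hP]; exists h; split; first split=> //.
- by move=> m phi; apply: hP; right.
- move=> phi Qphi; have [y Gy] := domG (in_boundary_vertex phi).
  have Py := partial_prism_vertex Gy; rewrite (hP _ _ _ Py).
  exact: vertex_cocartesian Qphi _ Py.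
move=> m phi bphi; have [y Gy] := domG bphi.
suff -> : @sact (sfun I01 M) _ _ phi h = y by [].
apply: smap_ext => k [t theta] /=; apply: hP; left.
split; first exact: in_boundary_comp.
exists (@sact (sfun I01 M) _ _ theta y); split; first by rewrite /= sact_comp; apply: Gs.
by rewrite /= dcomp_id.
Qed.

End Fill.

(** As [G0] covers the vertices, only cells of positive dimension remain; each has its first vertex
    in [Q], as [admissible_filler] asks. *)
Lemma relative_extension (G0 : graph K (sfun I01 M)) :
  stable G0 -> functional G0 -> gsub G0 admissible ->
  (forall x : K 0, dom G0 x) ->
  (forall n (x : K n), dom G0 x \/ Q (vertex x ord0)) ->
  exists A : smap (K \xs I01) M,
    [/\ p \os A = ssnd K I01, A \os at_end K end0 = a0 &
        forall n (x : K n) y, G0 n x y -> forall t, A n (x, t) = y n (t, did n)].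
Proof.
move=> G0s G0f G0R G0v G0Q.
have [] := @cell_extension K (sfun I01 M) admissible G0 admissible_stable G0s G0f G0R.
  move=> G Gs Gf GR G0G [|n] x ndx domG.
    by case: ndx; have [y /G0G] := G0v x; exists y.
  apply: admissible_filler => //; have [[y /G0G Gy]|//] := G0Q _ x.
  by case: ndx; exists y.
move=> F [FR FG]; exists (untranspose F); split.
- apply: smap_ext => n [x t]; have [pF _ _] := FR n x.
  exact: (smap_app pF n (t, did n)).
- apply: smap_ext => n x; have [_ F0 _] := FR n x.
  by rewrite /= F0 sact_id.
- by move=> n x y /FG Fx t; rewrite /= Fx.
Qed.

End RelativeExtension.

(** * Equivalences of functors from maps on [K \xs walking_iso] *)

(* The nerve of the contractible groupoid with objects false and true. *)
Definition walking_iso : sset :=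
  @SSet (fun n => 'I_n.+1 -> bool) (fun m n phi w i => w (phi i))
    (fun n w => funext (fun i => congr1 w (ffunE id i)))
    (fun k m n g f w => funext (fun i => congr1 w (ffunE (fun i => g (f i)) i))).

Definition walking_end (b : bool) n : walking_iso n := fun _ => b.
Arguments walking_end b n : clear implicits.

Section IsoEquivalence.
Variables (K X : sset) (T : smap (K \xs walking_iso) X).

Fact walking_simplex_subproof n (w : 'I_n.+1 -> bool) k m (psi : Dhom k m)
    (z : (K \xs sdelta n) m) :
  T k ((sact psi z).1, fun i => w ((sact psi z).2 i)) =
  sact psi (T m (z.1, fun i => w (z.2 i))).
Proof.
rewrite -sapp_nat /=; congr (T k (_, _)).
by apply/funext => i; rewrite !ffunE.
Qed.

Definition walking_simplex n (w : 'I_n.+1 -> bool) : sfun K X n :=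
  @SMap (K \xs sdelta n) X (fun m z => T m (z.1, fun i => w (z.2 i)))
    (walking_simplex_subproof w).

Lemma walking_simplex_act m n (phi : Dhom m n) (w : 'I_n.+1 -> bool)
    (w' : 'I_m.+1 -> bool) :
  w' =1 (fun i => w (phi i)) -> sact phi (walking_simplex w) = walking_simplex w'.
Proof.
move=> E; apply: smap_ext => k [x t] /=; congr (T k (_, _)).
by apply/funext => i; rewrite E !ffunE.
Qed.

(** The default [false] is never read when [l] has [n.+1] letters. *)
Definition bool_word n (l : seq bool) : 'I_n.+1 -> bool := fun i => nth false l i.

Lemma walking_composite (b0 b1 b2 : bool) :
  composite (walking_simplex (@bool_word 1 [:: b0; b1]))
            (walking_simplex (@bool_word 1 [:: b1; b2]))
            (walking_simplex (@bool_word 1 [:: b0; b2])).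
Proof.
exists (walking_simplex (@bool_word 2 [:: b0; b1; b2])).
split; apply: walking_simplex_act => i; rewrite /bool_word !ffunE /= /bump inordK //;
  by case: i => [[|[|]]].
Qed.

Lemma walking_source (b0 b1 : bool) :
  source (walking_simplex (@bool_word 1 [:: b0; b1])) =
  walking_simplex (@bool_word 0 [:: b0]).
Proof.
by apply: walking_simplex_act => i; rewrite /bool_word !ffunE (ord1 i).
Qed.

Lemma walking_target (b0 b1 : bool) :
  target (walking_simplex (@bool_word 1 [:: b0; b1])) =
  walking_simplex (@bool_word 0 [:: b1]).
Proof.
by apply: walking_simplex_act => i; rewrite /bool_word !ffunE (ord1 i).
Qed.

Lemma walking_id (b : bool) :
  id_edge (walking_simplex (@bool_word 0 [:: b])) =
  walking_simplex (@bool_word 1 [:: b; b]).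
Proof.
apply: walking_simplex_act => i; rewrite /bool_word !ffunE.
by case: i => [[|[|]]].
Qed.

(** The inverse edge is the word [[:: true; false]]. Both composites are constant words, which are
    identity edges by [walking_id], so all required triangles, homotopies included, are instances of
    [walking_composite]. *)
Lemma walking_iso_equivalent (a b : smap K X) :
  (forall n (x : K n), T n (x, walking_end false n) = a n x) ->
  (forall n (x : K n), T n (x, walking_end true n) = b n x) ->
  equivalent_functors a b.
Proof.
move=> Ta Tb.
have TE c (e : smap K X) : (forall n (x : K n), T n (x, walking_end c n) = e n x) ->
    walking_simplex (@bool_word 0 [:: c]) = sfun_vertex e.
  move=> Te; apply: smap_ext => n [x t]; rewrite -[RHS]Te /=.
  by congr (T n (_, _)); apply/funext => j; rewrite /bool_word (ord1 (t j)).
exists (walking_simplex (@bool_word 1 [:: false; true])); split.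
- by rewrite walking_source; apply: TE.
- by rewrite walking_target; apply: TE.
exists (walking_simplex (@bool_word 1 [:: true; false])).
exists (walking_simplex (@bool_word 1 [:: false; false])).
exists (walking_simplex (@bool_word 1 [:: true; true])).
rewrite /homotopic !walking_source !walking_target !walking_id.
split; exact: walking_composite.
Qed.

End IsoEquivalence.

(** * Fibers over the two ends of the interval *)

Lemma in_fiber_cases (K : sset) (s : smap K I01) n (x : K n) :
  in_fiber s end1 x \/ in_fiber s end0 (vertex x ord0).
Proof.
have H0 (t : 'I_2) : t <> end0 -> t = end1 by case: t => [[|[|]]] // ? H; [case: H|]; apply: val_inj.
have [sx|sx] := pselect (s n x ord0 = end0).
  by right; apply/eqP; rewrite sapp_nat; apply: Dhom_ext => i; rewrite !ffunE sx.
(* A simplex of the interval whose first vertex is 1 is constant, by monotonicity. *)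
left; apply/eqP; apply: Dhom_ext => i; rewrite ffunE; apply: val_inj => /=.
have := Dhom_homo (s n x) (leq0n i : (ord0 : 'I_n.+1) <= i).
by rewrite (H0 _ sx) /=; have := ltn_ord (s n x i); lia.
Qed.

Lemma in_fiber_vertex (K : sset) (s : smap K I01) (x : K 0) :
  in_fiber s end1 x \/ in_fiber s end0 x.
Proof.
have [?|] := in_fiber_cases s x; [by left|right].
suff <- : vertex x ord0 = x by [].
rewrite -[RHS]sact_id; congr (sact _ x).
by apply: Dhom_ext => i; rewrite !ffunE (ord1 i).
Qed.

(** Every [sact phi x] stays in the fiber, so the agreement covers the whole prism over [x]. *)
Lemma eq_on_fiber (K M : sset) (s : smap K I01) (b : 'I_2)
    (A B : smap (K \xs I01) M) :
  A \os sprod_map (fiber_incl s b) (smap_id I01) =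
    B \os sprod_map (fiber_incl s b) (smap_id I01) ->
  forall n (x : K n), in_fiber s b x -> transpose A n x = transpose B n x.
Proof.
move=> AB n x sx; apply: smap_ext => m [t phi] /=.
exact: (smap_app AB m ((exist _ (sact phi x) (in_fiber_act phi sx) : fiber s b m), t)).
Qed.

Lemma fiber_eq_on (K M : sset) (s : smap K I01) (b : 'I_2)
    (A B : smap (K \xs I01) M) :
  (forall n (x : K n) t, in_fiber s b x -> A n (x, t) = B n (x, t)) ->
  A \os sprod_map (fiber_incl s b) (smap_id I01) =
    B \os sprod_map (fiber_incl s b) (smap_id I01).
Proof. by move=> AB; apply: smap_ext => n [[x sx] t]; apply: AB. Qed.

Lemma fiber_lift (Z M D : sset) (p : smap M I01) (b : 'I_2)
    (iD : smap D (fiber p b)) (h : smap Z M) :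
  is_iso iD -> (forall n (z : Z n), p n (h n z) = dconst n b) ->
  exists T : smap Z D, h = fiber_incl p b \os iD \os T.
Proof.
move=> [j [_ ij]] ph.
have ph' n z : in_fiber p b (h n z) by apply/eqP/ph.
pose F n z : fiber p b n := exist _ (h n z) (ph' n z).
have F_nat m n (phi : Dhom m n) (z : Z n) : F m (sact phi z) = sact phi (F n z).
  by apply/fiber_inj/sapp_nat.
exists (j \os SMap F_nat); apply: smap_ext => n z.
exact: (esym (congr1 sval (smap_app ij n (F n z)))).
Qed.

Lemma fiber_incl_iso_mono (M D : sset) (p : smap M I01) (b : 'I_2)
    (iD : smap D (fiber p b)) :
  is_iso iD -> is_mono (fiber_incl p b \os iD).
Proof.
move=> [j [ji _]] n x y /fiber_inj E.
have K z : j n (iD n z) = z := smap_app ji n z.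
by rewrite -[x]K E K.
Qed.

(** * Existence and uniqueness of the adjunct lift *)

Theorem mainTheorem7 (M C D : sset) (p : smap M I01)
    (iC : smap C (fiber p end0)) (iD : smap D (fiber p end1))
    (f : smap C D) (g : smap D C)
    (u : smap (C \xs I01) M) (v : smap (D \xs I01) M)
    (Hp : adjunction p) (HiC : is_iso iC) (HiD : is_iso iD)
    (Huv : associated iC iD f g u v)
    (K K' : sset) (s : smap K I01) (i : smap K' K)
    (Hi : is_mono i) (Hfib : is_iso (fiber_map i s end1))
    (ta' : smap K' D) (a : smap K C)
    (Hadj : adjunct iC iD u v (s \os i) (a \os i) ta') :
  (exists ta : smap K D,
     ta \os i = ta' /\ adjunct iC iD u v s a ta) /\
  (forall ta1 ta2 : smap K D,
     ta1 \os i = ta' -> adjunct iC iD u v s a ta1 ->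
     ta2 \os i = ta' -> adjunct iC iD u v s a ta2 ->
     equivalent_functors ta1 ta2).
Proof.
have [_ _ [p_inner _]] := Hp.
have [u_over u0 _ u_cocart _ _ _ _] := Huv.
have D_mono := fiber_incl_iso_mono HiD.
(* Every simplex over 1 comes from [K'], where the lift is prescribed. *)
have fib1 n (x : K n) : in_fiber s end1 x -> exists x', x = i n x'.
  move=> sx; have [j [_ ij]] := Hfib.
  exists (sval (j n (exist _ x sx))).
  exact: (esym (congr1 sval (smap_app ij n (exist _ x sx)))).
pose ua := u \os sprod_map a (smap_id I01).
pose a0 := fiber_incl p end0 \os iC \os a.
have a0_over n (x : K n) : p n (a0 n x) = dconst n end0.
  exact: (eqP (svalP (iC n (a n x)))).
pose Q (k : K 0) : Prop := in_fiber s end0 k.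
have ua_over : p \os ua = ssnd K I01.
  by apply: smap_ext => n [x t]; apply: (smap_app u_over n (a n x, t)).
have ua0 : ua \os at_end K end0 = a0.
  by apply: smap_ext => n x; apply: (smap_app u0 n (a n x)).
have ua_cocart k : cocartesian_edge p (edge_at ua k).
  by have := u_cocart (a 0 k); rewrite /edge_at /= /id_edge sapp_nat.
have to_D (Z : sset) (B : smap (Z \xs I01) M) : p \os B = ssnd Z I01 ->
    exists T : smap Z D, B \os at_end Z end1 = fiber_incl p end1 \os iD \os T.
  by move=> pB; apply: fiber_lift => // n z; apply: (smap_app pB n (z, dconst n end1)).
split.
  have [A' [pA' [A'0 A'1 A'C A'D]]] := Hadj.
  (* The prescribed part is [A'] on the image of [i] and, as adjunctness forces, [ua] on the fiber
     over 0. *)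
  pose G0 : graph K (sfun I01 M) := fun n x y =>
    (exists x', x = i n x' /\ y = transpose A' n x') \/
    (in_fiber s end0 x /\ y = transpose ua n x).
  (* The two prescriptions agree on the overlap, by the condition on [A'] over 0. *)
  have A'ua n (x' : K' n) : in_fiber s end0 (i n x') ->
      transpose A' n x' = transpose ua n (i n x').
    move=> sx; have -> : transpose ua n (i n x') =
        transpose (ua \os sprod_map i (smap_id I01)) n x'.
      by apply: smap_ext => m [t phi]; rewrite /= !sapp_nat.
    have Eu : u \os sprod_map (a \os i) (smap_id I01) =
        ua \os sprod_map i (smap_id I01) by apply: smap_ext.
    by rewrite Eu in A'C; exact: (eq_on_fiber A'C sx).
  have [] := @relative_extension M p K a0 Q p_inner a0_over G0.
  - move=> m n phi x y [[x' [-> ->]]|[sx ->]]; rewrite -!sapp_nat; [left|right].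
      by exists (sact phi x').
    by split; first exact: in_fiber_act.
  - move=> n x y y' [[x' [Ex ->]]|[sx ->]] [[x'' [Ex' ->]]|[sx' ->]] //.
    + by rewrite Ex in Ex'; rewrite (Hi _ _ _ Ex').
    + by rewrite A'ua -?Ex.
    + by rewrite A'ua -?Ex'.
  - move=> n x y [[x' [-> ->]]|[sx ->]].
      apply: transpose_admissible => //; first by rewrite A'0; apply: smap_ext.
      move=> k Qk; have E : transpose A' 0 k = transpose ua 0 (i 0 k) by apply: A'ua.
      have /= := smap_app E 1 (did 1, dconst 1 ord0).
      by rewrite /edge_at /id_edge => ->; apply: ua_cocart.
    apply: (@transpose_admissible _ _ _ _ _ _ (smap_id K)) => //.
    by rewrite ua0; apply: smap_ext.
  - move=> x; have [/fib1[x' ->]|sx] := in_fiber_vertex s x.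
      by exists (transpose A' 0 x'); left; exists x'.
    by exists (transpose ua 0 x); right.
  - move=> n x; have [/fib1[x' ->]|sx] := in_fiber_cases s x; last by right.
    by left; exists (transpose A' n x'); left; exists x'.
  move=> A [pA A0 AG].
  have AA' n (x' : K' n) t : A n (i n x', t) = A' n (x', t).
    rewrite (AG n (i n x') (transpose A' n x')) /= ?sact_id //.
    by left; exists x'.
  have [ta Ata] := to_D _ _ pA.
  (* Both sides are compared in [M], where they are the ends over 1 of [A] and [A']. *)
  have taE n x' : ta n (i n x') = ta' n x'.
    apply: D_mono; apply: etrans (smap_app A'1 n x').
    exact: etrans (esym (smap_app Ata n (i n x'))) (AA' _ _ _).
  exists ta; split; first exact: smap_ext.
  exists A; split=> //; split=> //.
    apply: fiber_eq_on => n x t sx.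
    rewrite (AG n x (transpose ua n x)) /= ?sact_id //.
    by right.
  (* Over 1 the simplex comes from [K'], so the condition involving [v] is inherited from [A']. *)
  apply: fiber_eq_on => n x t sx; have [x' Ex] := fib1 n x sx.
  rewrite Ex /= AA' taE.
  have sx' : in_fiber (s \os i) end1 x' by rewrite /in_fiber /= -Ex.
  exact: (smap_app A'D n (exist _ x' sx', t)).
move=> ta1 ta2 ta1i [A1 [pA1 [A10 A11 A1C A1D]]] ta2i [A2 [pA2 [A20 A21 A2C A2D]]].
pose KJ := K \xs walking_iso.
pose ext (A : smap (K \xs I01) M) := A \os sprod_map (sfst K walking_iso) (smap_id I01).
(* Over 0 both maps are [u] applied to [a]; over 1 both are [v] applied to the values of [ta']. *)
have A12 n (x : K n) w : in_fiber s end0 x \/ in_fiber s end1 x ->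
    transpose (ext A1) n (x, w) = transpose (ext A2) n (x, w).
  suff E : in_fiber s end0 x \/ in_fiber s end1 x -> transpose A1 n x = transpose A2 n x.
    by move/E => {}E; apply: smap_ext => m z; apply: (smap_app E m z).
  case; apply: eq_on_fiber; first by rewrite A1C A2C.
  rewrite A1D A2D; apply: fiber_eq_on => k y t /fib1[y' ->] /=.
  by have /= -> := smap_app ta1i k y'; have /= -> := smap_app ta2i k y'.
pose G0 : graph KJ (sfun I01 M) := fun n x y =>
  ((in_fiber s end0 x.1 \/ in_fiber s end1 x.1) \/ x.2 = walking_end false n) /\
    y = transpose (ext A1) n x \/
  x.2 = walking_end true n /\ y = transpose (ext A2) n x.
have ext_over A : p \os A = ssnd K I01 -> p \os ext A = ssnd KJ I01.
  by move=> pA; apply: smap_ext => n [[x w] t]; apply: (smap_app pA n (x, t)).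
have ext0 A : A \os at_end K end0 = a0 -> ext A \os at_end KJ end0 = a0 \os sfst _ _.
  by move=> A0; apply: smap_ext => n [x w]; apply: (smap_app A0 n x).
have ext_cocart A : A \os sprod_map (fiber_incl s end0) (smap_id I01) =
    ua \os sprod_map (fiber_incl s end0) (smap_id I01) ->
    forall k : KJ 0, Q k.1 -> cocartesian_edge p (edge_at (ext A) k).
  move=> Afib k Qk; have E : transpose A 0 k.1 = transpose ua 0 k.1 by apply: (eq_on_fiber Afib).
  have /= := smap_app E 1 (did 1, dconst 1 ord0).
  by rewrite /edge_at /id_edge /= => ->; apply: ua_cocart.
(* No simplex lies at both ends, so the two clauses of [G0] overlap only over the fibers of [K],
   where [A12] applies. *)
have ends n : walking_end false n <> walking_end true n.
  by move/(congr1 (fun w : 'I_n.+1 -> bool => w ord0)).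
have [] := @relative_extension M p KJ (a0 \os sfst _ _) (fun k => Q k.1) p_inner
  (fun n x => a0_over n x.1) G0.
- move=> m n phi x y [[Hx ->]|[Hx ->]]; rewrite -!sapp_nat; [left|right]; split=> //=.
    case: Hx => [[sx|sx]|->]; [left; left|left; right|by right]; exact: in_fiber_act.
  by rewrite Hx.
- move=> n [x w] y y' [[/= Hx ->]|[/= Hx ->]] [[/= Hx' ->]|[/= Hx' ->]] //.
    by case: Hx => [?|Hx]; [exact: A12|case: (ends n); rewrite -Hx -Hx'].
  by case: Hx' => [?|Hx']; [exact/esym/A12|case: (ends n); rewrite -Hx' -Hx].
- move=> n x y [[_ ->]|[_ ->]]; apply: (@transpose_admissible _ _ _ _ _ _ (smap_id KJ)).
  + exact: ext_over.
  + by rewrite ext0 //; apply: smap_ext.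
  + exact: ext_cocart.
  + exact: ext_over.
  + by rewrite ext0 //; apply: smap_ext.
  + exact: ext_cocart.
- move=> x; exists (transpose (ext A1) 0 x); left; split=> //; left.
  by have [?|?] := in_fiber_vertex s x.1; [right|left].
- move=> n x; have [?|?] := in_fiber_cases s x.1; last by right.
  by left; exists (transpose (ext A1) n x); left; split=> //; left; right.
move=> B [pB _ BG].
have [T BT] := to_D _ _ pB.
(* At [false] and [true], [B] restricts to [A1] and [A2]; comparing their ends over 1 in [M]
   identifies the ends of [T] with [ta1] and [ta2]. *)
apply: (walking_iso_equivalent (T := T)) => n x; apply: D_mono.
  apply: etrans (smap_app A11 n x).
  apply: etrans (esym (smap_app BT n (x, walking_end false n))) _.
  rewrite /= (BG n (x, walking_end false n) _ (or_introl (conj (or_intror erefl) erefl))).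
  by rewrite /= sact_id.
apply: etrans (smap_app A21 n x).
apply: etrans (esym (smap_app BT n (x, walking_end true n))) _.
rewrite /= (BG n (x, walking_end true n) _ (or_intror (conj erefl erefl))).
by rewrite /= sact_id.
Qed.
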